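(* Let $n\ge 1$, let $w_1\ge \dots\ge w_n\ge 0$ be real numbers with $\sum_{i=1}^n w_i=1$, and let $q$ be a real number with $0<q<1$. Let $(N,v)$ be the weighted majority game with player set $N=\{1,\dots,n\}$ represented by $[q;w]=[q;w_1,\dots,w_n]$, and let $x^*$ be the nucleolus of $(N,v)$. Then $$\Vert x^*-w\Vert_1\le \frac{2w_1}{\min\{q,1-q\}}.$$
   Context: The weighted majority game represented by $[q;w_1,\dots,w_n]$ (quota $q$, weights $w_i\ge 0$) is the function $v$ on subsets $S$ of $N=\{1,\dots,n\}$ given by $v(S)=1$ if $\sum_{i\in S}w_i\ge q$ and $v(S)=0$ otherwise. For $x\in\mathbb{R}^n$ write $x(S)=\sum_{i\in S}x_i$. An imputation is a vector $x\in\mathbb{R}^n$ with $x_i\ge v(\{i\})$ for all $i\in N$ and $x(N)=v(N)$. The excess of $S\subseteq N$ at an imputation $x$ is $e(S,x)=v(S)-x(S)$. Let $E(x)\in\mathbb{R}^{2^n}$ be the vector of the excesses of all $2^n$ coalitions $S\subseteq N$ at $x$, arranged in weakly decreasing order. An imputation $x$ is lexicographically less than an imputation $y$ if $E_k(x)<E_k(y)$ for the smallest index $k$ with $E_k(x)\ne E_k(y)$. The nucleolus of $(N,v)$ is the unique lexicographically minimal imputation; it is defined whenever the set of imputations is nonempty (for the games considered here: whenever at most one singleton coalition $\{i\}$ has $v(\{i\})=1$), and a statement about the nucleolus presupposes that it is defined. $\Vert x\Vert_1=\sum_{i=1}^n |x_i|$. *)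

(* Defs.v *)
From mathcomp Require Import all_boot all_order all_algebra.
From mathcomp Require Import reals.

Set Implicit Arguments.
Unset Strict Implicit.
Unset Printing Implicit Defensive.

Import Order.TTheory GRing.Theory Num.Theory.
Local Open Scope ring_scope.

Section Games.
Variables (R : realType) (n : nat).
Implicit Types (v : {set 'I_n} -> R) (w x y : 'rV[R]_n) (S : {set 'I_n}).

Definition l1norm x : R := \sum_i `|x 0 i|.

Definition coal_sum x S : R := \sum_(i in S) x 0 i.

Definition weighted_majority (q : R) w : {set 'I_n} -> R :=
  fun S => if q <= coal_sum w S then 1 else 0.

Definition imputation v x : Prop :=
  (forall i, v [set i] <= x 0 i) /\ coal_sum x [set: 'I_n] = v [set: 'I_n].

Definition excess v S x : R := v S - coal_sum x S.

(* A sequence of size 2 ^ n: coalitions with equal excess are all listed. *)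
Definition excess_vector v x : seq R :=
  sort (fun a b : R => b <= a) [seq excess v A x | A : {set 'I_n}].

(* The k-th entries are the first ones that differ. *)
Definition lex_less v x y : Prop :=
  exists k : nat, [/\ (k < 2 ^ n)%N,
    forall j : nat, (j < k)%N -> (excess_vector v x)`_j = (excess_vector v y)`_j
    & (excess_vector v x)`_k < (excess_vector v y)`_k].

(* Lexicographic minimality among the imputations. That at most one imputation
   is minimal is a theorem of Schmeidler, not part of the definition. *)
Definition is_nucleolus v x : Prop :=
  imputation v x /\ forall y, imputation v y -> ~ lex_less v y x.

End Games.

(* Main.v *)
Require Import Defs.
From mathcomp Require Import all_boot all_order all_algebra.
From mathcomp Require Import reals.
From mathcomp Require Import lra.

Import Order.TTheory GRing.Theory Num.Theory.
Local Open Scope ring_scope.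

(** The only property of the nucleolus [x] that is needed is that it minimizes
    the largest excess.  If [w_1 < q], then no single player wins, so [w] itself
    is an imputation; its excesses are at most [1 - q], since a winning coalition
    has weight at least [q].  Hence the same bound holds at [x], which says that
    [q <= x(S)] for every winning coalition [S].

    Let [P] be the set of players with [x_i < w_i] and [d = w(P) - x(P)], so that
    [|x - w|_1 = 2 d].  Assume for the moment that weights are infinitely
    divisible.  If [q <= w(P)], then the part of [P] with weight [q] that is
    cheapest in terms of [x] has [x]-value at most [q (1 - d / w(P))], so [d = 0];
    if [w(P) < q], then the cheapest way of completing [P] to weight [q] gives the
    same conclusion.  Since players are indivisible, the weight of the coalition
    may exceed [q] by up to [w_1]; this costs [d <= w_1 / q] in the first case and
    [d <= w_1 / (1 - q)] in the second ([deficit_le]).  The cheap coalition is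
    provided by [cheap_subset].

    If [q <= w_1], then the right-hand side is at least [2], which bounds the
    distance of any two vectors of the standard simplex. *)

(** The set [S] arises from [A] by discarding, one at a time, an element whose
    ratio [y i / w i] is at least the average [y(A) / w(A)]: this never increases
    the average, and as each step lowers the weight by at most [m], the window
    from [c] to [c + m] is not jumped over.  The comparison
    of averages is cleared of denominators because elements may have weight
    zero. *)
Lemma cheap_subset (R : realDomainType) (T : finType) (w y : T -> R) (c m : R)
    (A : {set T}) :
  (forall i, w i <= m) -> 0 <= c -> 0 <= m -> c <= \sum_(i in A) w i ->
  exists S : {set T}, [/\ S \subset A,
    c <= \sum_(i in S) w i <= c + m &
    (\sum_(i in S) y i) * (\sum_(i in A) w i)
      <= (\sum_(i in A) y i) * (\sum_(i in S) w i)].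
Proof.
move=> w_le c_ge0 m_ge0; have [k] := ubnP #|A|.
elim: k A => // k IHk A ltAk cA.
have [small|big] := lerP (\sum_(i in A) w i) (c + m).
  by exists A; rewrite subxx cA small; split.
(* An element of at least average ratio exists: the two sides have the same sum
   over [A]. *)
have [i iA ratio_i] : exists2 i, i \in A &
    w i * (\sum_(j in A) y j) <= y i * (\sum_(j in A) w j).
  apply/exists_inP/contraT => /exists_inPn noi.
  have A_neq0 : A != set0.
    apply: contraTneq big => ->; rewrite big_set0 -leNgt; lra.
  have /set0Pn [i0 i0A] := A_neq0.
  suff : \sum_(i in A) y i * (\sum_(j in A) w j)
       < \sum_(i in A) w i * (\sum_(j in A) y j).
    by rewrite -!mulr_suml mulrC ltxx.
  apply: ltr_sum => [|j jA]; first by apply/hasP; exists i0; rewrite ?mem_index_enum.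
  by rewrite ltNge noi.
have wA := @big_setD1 _ _ _ _ i A w iA : _ = w i + _.
have yA := @big_setD1 _ _ _ _ i A y iA : _ = y i + _.
have w_le_i := w_le i.
have cD : c < \sum_(j in A :\ i) w j by move: big; rewrite wA; lra.
have [||S [SD wS yS]] := IHk (A :\ i).
- by move: ltAk; rewrite (cardsD1 i A) iA.
- exact: ltW.
exists S; split=> //; first exact: subset_trans SD (subsetDl _ _).
have wS_ge0 : 0 <= \sum_(j in S) w j by case/andP: wS; lra.
have wD_gt0 : 0 < \sum_(j in A :\ i) w j by lra.
have wA_ge0 : 0 <= \sum_(j in A) w j by lra.
have ratio_D : (\sum_(j in A :\ i) y j) * (\sum_(j in A) w j)
    <= (\sum_(j in A) y j) * (\sum_(j in A :\ i) w j).
  by move: ratio_i; rewrite wA yA; lra.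
rewrite -(ler_pM2r wD_gt0) mulrAC.
apply: le_trans (ler_wpM2r wA_ge0 yS) _.
by rewrite mulrAC [leRHS]mulrAC; apply: ler_wpM2r.
Qed.

(** Lexicographic minimality is compared at the first entry, which is the
    largest excess. *)
Lemma nucleolus_excess_le (R : realType) (n : nat) (v : {set 'I_n} -> R)
    (x y : 'rV[R]_n) (b : R) :
  is_nucleolus v x -> imputation v y -> (forall S, excess v S y <= b) ->
  forall S, excess v S x <= b.
Proof.
move=> [_ x_min] y_imp y_le S; rewrite leNgt; apply/negP => lt_b.
apply: (x_min y y_imp); exists 0%N; split=> //; first by rewrite expn_gt0.
have size_gt0 z : (0 < size (excess_vector v z))%N.
  by rewrite size_sort size_map -cardE; apply/card_gt0P; exists S.
have y0_le : (excess_vector v y)`_0 <= b.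
  have := mem_nth 0 (size_gt0 y).
  by rewrite {2}/excess_vector mem_sort => /mapP [B _ ->].
have x0_ge : excess v S x <= (excess_vector v x)`_0.
  have : excess v S x \in excess_vector v x.
    by rewrite mem_sort; apply: (image_f (fun B => excess v B x)).
  have : sorted (fun a b : R => b <= a) (excess_vector v x).
    by apply: sort_sorted => a c; exact: le_total.
  case: (excess_vector v x) => //= a s pas.
  rewrite inE => /predU1P [->//|]; apply/allP: (excess v S x).
  by apply: order_path_min pas => ? ? ? ab bc; apply: le_trans bc ab.
exact: le_lt_trans y0_le (lt_le_trans lt_b x0_ge).
Qed.

Section Distance.

Variables (R : realType) (n : nat).
Implicit Types (w x : 'rV[R]_n) (q m : R).

Lemma coal_sumB x w (S : {set 'I_n}) :
  coal_sum (x - w) S = coal_sum x S - coal_sum w S.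
Proof. by rewrite -sumrB; apply: eq_bigr => i _; rewrite !mxE. Qed.

Lemma coal_sumT x : coal_sum x [set: 'I_n] = \sum_i x 0 i.
Proof. by apply: eq_bigl => i; rewrite inE. Qed.

Lemma coal_sum_ge0 x (S : {set 'I_n}) :
  (forall i, 0 <= x 0 i) -> 0 <= coal_sum x S.
Proof. by move=> x_ge0; apply: sumr_ge0. Qed.

Lemma coal_sumU x (S T : {set 'I_n}) :
  [disjoint S & T] -> coal_sum x (S :|: T) = coal_sum x S + coal_sum x T.
Proof.
move=> dST; rewrite /coal_sum -bigU //.
by apply: eq_bigl => i; rewrite !inE.
Qed.

Lemma coal_sumC x (S : {set 'I_n}) :
  coal_sum x [set: 'I_n] = coal_sum x S + coal_sum x (~: S).
Proof. by rewrite -coal_sumU ?setUCr // -setI_eq0 setICr. Qed.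

Lemma l1norm_le2 x w :
  (forall i, 0 <= x 0 i) -> (forall i, 0 <= w 0 i) ->
  coal_sum x [set: 'I_n] = 1 -> coal_sum w [set: 'I_n] = 1 ->
  l1norm (x - w) <= 2.
Proof.
move=> x_ge0 w_ge0 x1 w1.
have -> : 2 = \sum_i (x 0 i + w 0 i) :> R.
  by rewrite big_split /= -!coal_sumT x1 w1.
apply: ler_sum => i _; rewrite !mxE.
by apply: le_trans (ler_normB _ _) _; rewrite !ger0_norm.
Qed.

(** As [x] and [w] have the same total, the surplus of [x] outside [P] equals
    its deficit on [P]. *)
Lemma l1norm_deficit x w (P := [set i | x 0 i < w 0 i]) :
  coal_sum x [set: 'I_n] = coal_sum w [set: 'I_n] ->
  l1norm (x - w) = 2 * (coal_sum w P - coal_sum x P).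
Proof.
rewrite (coal_sumC x P) (coal_sumC w P) => tot.
have -> : l1norm (x - w) = - coal_sum (x - w) P + coal_sum (x - w) (~: P).
  rewrite /l1norm (bigID (mem P)) /= -sumrN; congr (_ + _).
    by apply: eq_bigr => i; rewrite inE !mxE => lt_i; rewrite ltr0_norm ?subr_lt0.
  rewrite /coal_sum; apply: eq_big => i; first by rewrite in_setC.
  by rewrite inE -leNgt !mxE => le_i; rewrite ger0_norm ?subr_ge0.
rewrite !coal_sumB; lra.
Qed.

(** Every winning coalition [S] satisfies [w(S) - x(S) <= w(S) - q], so a
    winning coalition that barely exceeds the quota has a small deficit.  On the
    other hand, choosing [S] by [cheap_subset] makes its deficit at least a share
    of [d = w(P) - x(P)]: the share [w(S) / w(P)] if [P] wins and [S] lies in [P],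
    the share [(1 - w(S)) / (1 - w(P))] if [P] loses and [S] contains [P]. *)
Lemma deficit_le x w q m (P : {set 'I_n}) :
  (forall i, 0 <= x 0 i) -> (forall i, 0 <= w 0 i) ->
  (forall i, w 0 i <= m) -> 0 <= m ->
  coal_sum x [set: 'I_n] = 1 -> coal_sum w [set: 'I_n] = 1 ->
  0 < q < 1 ->
  (forall S, q <= coal_sum w S -> q <= coal_sum x S) ->
  coal_sum w P - coal_sum x P <= m / Num.min q (1 - q).
Proof.
move=> x_ge0 w_ge0 w_le m_ge0 x1 w1 /andP[q_gt0 q_lt1] x_win.
have xP_ge0 := coal_sum_ge0 x P x_ge0.
have wP_ge0 := coal_sum_ge0 w P w_ge0.
have wC_ge0 := coal_sum_ge0 w (~: P) w_ge0.
have x1P := coal_sumC x P; have w1P := coal_sumC w P.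
rewrite x1 in x1P; rewrite w1 in w1P.
have min_gt0 : 0 < Num.min q (1 - q) by rewrite lt_min q_gt0 subr_gt0.
set d := coal_sum w P - coal_sum x P.
rewrite ler_pdivlMr //.
have [d_le0|d_gt0] := lerP d 0.
  by apply: le_trans m_ge0; rewrite mulr_le0_ge0 // ltW.
have [qP|Pq] := lerP q (coal_sum w P).
  have [S [_ /andP[qS Sq] xS]] :=
    cheap_subset R _ (w 0) ((x - w) 0) q m P w_le (ltW q_gt0) m_ge0 qP.
  apply: (@le_trans _ _ (d * q)); first by rewrite ler_pM2l // ge_min lexx.
  move: qS Sq xS.
  rewrite -!/(coal_sum (x - w) _) -!/(coal_sum w _) !coal_sumB => qS Sq xS.
  have xqS := x_win S qS.
  (* [d q <= d w(S) <= (w(S) - x(S)) w(P) <= (w(S) - q) w(P) <= m]. *)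
  rewrite /d in d_gt0 *; nra.
have [||S [SP /andP[cS Sc] xS]] :=
    cheap_subset R _ (w 0) ((x - w) 0) (q - coal_sum w P) m (~: P) w_le _ m_ge0.
- by rewrite subr_ge0 ltW.
- rewrite -/(coal_sum _ _); lra.
apply: (@le_trans _ _ (d * (1 - q))).
  by rewrite ler_pM2l // ge_min lexx orbT.
move: cS Sc xS.
rewrite -!/(coal_sum (x - w) _) -!/(coal_sum w _) !coal_sumB => cS Sc xS.
have dPS : [disjoint P & S].
  by rewrite disjoint_sym disjoints_subset.
have := x_win (P :|: S); rewrite !coal_sumU // => /(_ ltac:(lra)) xqS.
(* The surplus weight [t] of the completed coalition satisfies
   [d (1 - q - t) <= t (1 - w(P))], and [d <= w(P)] absorbs the term [d t]. *)
set t := coal_sum w P + coal_sum w S - q.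
have t_ge0 : 0 <= t by rewrite /t; lra.
have d_le : d <= coal_sum w P by rewrite /d; lra.
suff : d * (1 - q) <= t * (1 - coal_sum w P + d).
  have : t * (1 - coal_sum w P + d) <= t * 1 by rewrite ler_wpM2l //; lra.
  rewrite /t; lra.
have key : d * (1 - q - t) <= t * (1 - coal_sum w P).
  have wC : coal_sum w (~: P) = 1 - coal_sum w P by lra.
  have dxS : d - (coal_sum x S - coal_sum w S) <= t by rewrite /d /t; lra.
  have := ler_wpM2r wC_ge0 dxS.
  have xC : coal_sum x (~: P) - coal_sum w (~: P) = d by rewrite /d; lra.
  rewrite xC in xS; move: xS; rewrite wC /t; lra.
lra.
Qed.

End Distance.

Lemma weighted_majority_ge0 (R : realType) (n : nat) (q : R) (w : 'rV[R]_n) S :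
  0 <= weighted_majority q w S.
Proof. by rewrite /weighted_majority; case: ifP. Qed.

Theorem lemma1 (R : realType) (n : nat) (n_gt0 : (0 < n)%N)
    (w : 'rV[R]_n) (q : R) (x : 'rV[R]_n)
    (w_nonincreasing : forall i j : 'I_n, (i <= j)%N -> w 0 j <= w 0 i)
    (w_ge0 : forall i : 'I_n, 0 <= w 0 i)
    (w_sum1 : \sum_(i < n) w 0 i = 1)
    (q_gt0 : 0 < q) (q_lt1 : q < 1)
    (x_nucleolus : is_nucleolus (weighted_majority q w) x) :
  l1norm (x - w) <= 2 * w 0 (Ordinal n_gt0) / Num.min q (1 - q).
Proof.
set m := w 0 (Ordinal n_gt0).
have w_le i : w 0 i <= m by apply: w_nonincreasing.
have w1 : coal_sum w [set: 'I_n] = 1 by rewrite coal_sumT.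
have vN : weighted_majority q w [set: 'I_n] = 1.
  by rewrite /weighted_majority w1 ltW.
have [[x_ind x_eff] _] := x_nucleolus.
have x_ge0 i : 0 <= x 0 i.
  exact: le_trans (weighted_majority_ge0 _ _ _ _ _) (x_ind i).
have x1 : coal_sum x [set: 'I_n] = 1 by rewrite x_eff.
have min_gt0 : 0 < Num.min q (1 - q) by rewrite lt_min q_gt0 subr_gt0.
have [qm|mq] := lerP q m.
  apply: le_trans (l1norm_le2 _ _ _ _ x_ge0 w_ge0 x1 w1) _.
  by rewrite ler_pdivlMr // ler_pM2l // ge_min qm.
have w_imp : imputation (weighted_majority q w) w.
  split=> [i|]; last by rewrite w1.
  rewrite /weighted_majority /coal_sum big_set1.
  by rewrite [q <= _]leNgt (le_lt_trans (w_le i) mq).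
have w_excess S : excess (weighted_majority q w) S w <= 1 - q.
  rewrite /excess /weighted_majority; have := coal_sum_ge0 _ _ w S w_ge0.
  by case: (lerP q (coal_sum w S)); lra.
have x_excess := nucleolus_excess_le _ _ _ _ _ _ x_nucleolus w_imp w_excess.
have x_win S : q <= coal_sum w S -> q <= coal_sum x S.
  by move=> qS; have := x_excess S; rewrite /excess /weighted_majority qS; lra.
rewrite l1norm_deficit ?x1 ?w1 // -mulrA ler_pM2l //.
apply: deficit_le => //; last by rewrite q_gt0.
exact: w_ge0.
Qed.
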